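(* Let $\Gamma$ be a finite connected graph without loops and multiple edges. Then the zigzag algebra $A(\Gamma)$ is a graded symmetric algebra.
   Context: Zigzag algebra $A(\Gamma)$ over $\mathbb C$: the double $D\Gamma$ of $\Gamma$ has the same vertices, with each edge replaced by two oppositely oriented edges. A path is written as the list $(a_1|\dots|a_k)$ of vertices it visits; the product is concatenation of paths (zero if not concatenable). If $\Gamma$ has more than two vertices, $A(\Gamma)$ is the path algebra of $D\Gamma$ modulo the two-sided ideal generated by (i) $(a|b|c)$ for $a,b$ connected, $b,c$ connected, $a\neq c$, and (ii) $(a|b|a)-(a|c|a)$ whenever $a$ is connected to both $b$ and $c$. If $\Gamma$ consists of two vertices joined by an edge, $A(\Gamma)$ is the path algebra of $D\Gamma$ modulo all paths of length greater than $2$. If $\Gamma$ is a single vertex, $A(\Gamma)=\mathbb C[X]/(X^2)$. The grading is by path length (with $\deg X=2$ in the one-vertex case). A finite-dimensional $\mathbb C$-algebra $A$ is symmetric if it possesses a nondegenerate symmetric trace map $\mathrm{tr}:A\to\mathbb C$, i.e. $\mathrm{tr}(xy)=\mathrm{tr}(yx)$ and the bilinear form $(x,y)\mapsto\mathrm{tr}(xy)$ is nondegenerate; graded symmetric means that $A$ is graded and such a trace can be chosen homogeneous (of some degree). *)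

(* Defs.v *)
From HB Require Import structures.
From mathcomp Require Import all_boot all_algebra finmap monalg.
From mathcomp Require Import boolp classical_sets reals complex.

Set Implicit Arguments.
Unset Strict Implicit.
Unset Printing Implicit Defensive.

Import GRing.Theory.
Import Quotient.
Local Open Scope classical_set_scope.
Local Open Scope ring_scope.
Local Open Scope quotient_scope.

(* The symmetric irreflexive relation [adj] encodes a graph without loops and
   multiple edges; connected graphs are nonempty. *)
Record connGraph := ConnGraph {
  vertex :> finType;
  adj : rel vertex;
  adj_sym : symmetric adj;
  adj_irrefl : irreflexive adj;
  vertex_gt0 : (0 < #|vertex|)%N;
  adj_connected : forall a b, connect adj a b }.
Arguments adj {c}.

Section Paths.
Variable G : connGraph.

(* A path (a_1|...|a_k) of the double of G is stored as (a_1, [:: a_2; ...]);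
   the trivial path (a) is (a, [::]).  As G has no multiple edges, an arrow of
   the double is determined by its source and target. *)
Definition qpath : Type := {p : G * seq G | path adj p.1 p.2}.
HB.instance Definition _ := SubChoice.on qpath.

Implicit Types p q r : qpath.

Definition psrc p : G := (val p).1.
Definition ptgt p : G := last (val p).1 (val p).2.
Definition plen p : nat := size (val p).2.

Definition triv_path (a : G) : qpath := Sub (a, [::]) isT.

(* The partial concatenation (a_1|...|a_k)(a_k|b_2|...|b_l); when the
   endpoints match, [insub] always succeeds. *)
Definition pcat p q : option qpath :=
  if ptgt p == psrc q
  then (insub (psrc p, (val p).2 ++ (val q).2) : option qpath) else None.

Variant pcat_spec p q : option qpath -> Prop :=
| PcatSome r of ptgt p = psrc q & val r = (psrc p, (val p).2 ++ (val q).2) :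
    pcat_spec p q (Some r)
| PcatNone of ptgt p <> psrc q : pcat_spec p q None.

Lemma pcatP p q : pcat_spec p q (pcat p q).
Proof.
rewrite /pcat; case: eqP => [e|]; last by constructor.
have h : path adj (psrc p, (val p).2 ++ (val q).2).1
                  (psrc p, (val p).2 ++ (val q).2).2.
  by rewrite /= cat_path (valP p) -/(ptgt p) e; exact: valP q.
by rewrite (insubT (fun u : G * seq G => path adj u.1 u.2) h); constructor.
Qed.

Lemma pcat_src p q r : pcat p q = Some r -> psrc r = psrc p.
Proof. by case: pcatP => // r' _ e [<-]; rewrite /psrc e. Qed.

Lemma pcat_tgt p q r : pcat p q = Some r -> ptgt r = ptgt q.
Proof.
by case: pcatP => // r' e0 e [<-]; rewrite /ptgt e /= last_cat -/(ptgt p) e0.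
Qed.

Lemma pcat_len p q r : pcat p q = Some r -> plen r = (plen p + plen q)%N.
Proof. by case: pcatP => // r' e0 e [<-]; rewrite /plen e /= size_cat. Qed.

Lemma pcatA p q r :
  obind (pcat p) (pcat q r) = obind (fun s => pcat s r) (pcat p q).
Proof.
case E1: (pcat q r) => [s|] /=; case E2: (pcat p q) => [t|] //=.
- have := pcat_src E1; have := pcat_tgt E2.
  case: (pcatP p s) => [u e1 v1|n1]; case: (pcatP t r) => [w e2 v2|n2] //.
  + move=> _ _; congr Some; apply: val_inj; rewrite v1 v2.
    move: E1 E2; case: pcatP => // ? _ e [<-]; case: pcatP => // ? _ e' [<-].
    by rewrite e /psrc e' /= catA.
  + move=> e e'; case: n2; rewrite e.
    by move: E1; case: pcatP.
  + move=> e e'; case: n1; rewrite e'.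
    by move: E2; case: pcatP.
- have := pcat_src E1; case: (pcatP p s) => // u e1 v1 e.
  by move: E2; case: pcatP => // n; case: n; rewrite e1 e.
- have := pcat_tgt E2; case: (pcatP t r) => // u e1 v1 e.
  by move: E1; case: pcatP => // n; case: n; rewrite -e1 e.
Qed.

Lemma pcat1p a p : pcat (triv_path a) p = if a == psrc p then Some p else None.
Proof.
case: pcatP => [r e v|n].
  rewrite -e /ptgt /= eqxx; congr Some; apply: val_inj; rewrite v /psrc /=.
  by rewrite [RHS]surjective_pairing -/(psrc p) -e.
by case: eqP => // e; case: n.
Qed.

Lemma pcatp1 a p : pcat p (triv_path a) = if a == ptgt p then Some p else None.
Proof.
case: pcatP => [r e v|n].
  rewrite e /psrc /= eqxx; congr Some; apply: val_inj; rewrite v /= cats0.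
  by rewrite [RHS]surjective_pairing.
by case: eqP => // e; case: n.
Qed.

End Paths.

Section Bilinear.
Variables (K : fieldType) (V : lmodType K) (I : Type) (b : I -> V).
Hypothesis b_ind : forall P : V -> Prop,
  P 0 -> (forall c i x, P x -> P (c *: b i + x)) -> forall x, P x.

Lemma bilinear_ext (f : V -> V) :
  {morph f : x y / x + y} -> (forall c, {morph f : x / c *: x}) ->
  (forall i, f (b i) = b i) -> f =1 id.
Proof.
move=> fD fZ fb; elim/b_ind => [|c i x IHx]; last by rewrite fD fZ fb IHx.
by rewrite -[0 in LHS](scale0r 0) fZ scale0r.
Qed.

Variable m : V -> V -> V.
Hypotheses (mDl : left_distributive m +%R) (mDr : right_distributive m +%R).
Hypotheses (mZl : forall c x y, m (c *: x) y = c *: m x y)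
           (mZr : forall c x y, m x (c *: y) = c *: m x y).

Lemma bilinear_assoc :
  (forall i j k, m (b i) (m (b j) (b k)) = m (m (b i) (b j)) (b k)) ->
  associative m.
Proof.
have m0x x : m 0 x = 0 by rewrite -[0 in LHS](scale0r 0) mZl scale0r.
have mx0 x : m x 0 = 0 by rewrite -[0 in LHS](scale0r 0) mZr scale0r.
move=> mb x y z.
elim/b_ind: x => [|c i x IHx]; first by rewrite !m0x.
rewrite !mDl !mZl IHx; congr (_ *: _ + _).
elim/b_ind: y {IHx} => [|d j y IHy]; first by rewrite mx0 !m0x mx0.
rewrite !(mDl, mDr) IHy !(mZl, mZr) ; congr (_ *: _ + _).
elim/b_ind: z {IHy} => [|e k z IHz]; first by rewrite !mx0.
by rewrite !mDr IHz !mZr mb.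
Qed.

End Bilinear.
Arguments bilinear_ext {K V I b} _ {f}.
Arguments bilinear_assoc {K V I b} _ {m}.

Section PathAlgebra.
Variables (K : fieldType) (G : connGraph).

Local Notation kpaths := {malg K[qpath G]}.

Implicit Types (x y z : kpaths) (p q r : qpath G).

Definition pvec p : kpaths := << p >>.

Definition pmulb p q : kpaths := if pcat p q is Some r then pvec r else 0.

Definition pmul x y : kpaths :=
  \sum_(p <- msupp x) \sum_(q <- msupp y) (x@_p * y@_q) *: pmulb p q.

Definition pone : kpaths := \sum_(a : G) pvec (triv_path a).

Lemma mcoeff_pvec p q : (pvec p)@_q = (p == q)%:R.
Proof. by rewrite /pvec [LHS]mcoeffU. Qed.

Lemma malg_scaleU (c : K) p : << c *g p >> = c *: pvec p :> kpaths.
Proof.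
by apply/malgP => k; rewrite [LHS]mcoeffU mcoeffZ mcoeff_pvec mulr_natr.
Qed.

Lemma pathAlgE x : x = \sum_(p <- msupp x) x@_p *: pvec p.
Proof. by rewrite {1}[x]monalgE; apply: eq_bigr => p _; rewrite malg_scaleU. Qed.

Lemma pmulw (d1 d2 : {fset qpath G}) x y :
  (msupp x `<=` d1)%fset -> (msupp y `<=` d2)%fset ->
  pmul x y = \sum_(p <- d1) \sum_(q <- d2) (x@_p * y@_q) *: pmulb p q.
Proof.
move=> le1 le2; rewrite /pmul (big_fset_incl _ le1) /=.
  apply: eq_bigr => p _; apply: big_fset_incl => // q _ /mcoeff_outdom ->.
  by rewrite mulr0 scale0r.
move=> p _ /mcoeff_outdom xp.
by rewrite big1 // => q _; rewrite xp mul0r scale0r.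
Qed.

Lemma pmulDl : left_distributive pmul +%R.
Proof.
move=> x y z.
rewrite (pmulw (msuppD_le x y) (fsubset_refl _)).
rewrite (pmulw (fsubsetUl _ (msupp y)) (fsubset_refl (msupp z))).
rewrite (pmulw (fsubsetUr (msupp x) _) (fsubset_refl (msupp z))).
rewrite -big_split; apply: eq_bigr => p _ /=.
rewrite -big_split; apply: eq_bigr => q _ /=.
by rewrite mcoeffD mulrDl scalerDl.
Qed.

Lemma pmulDr : right_distributive pmul +%R.
Proof.
move=> z x y.
rewrite (pmulw (fsubset_refl _) (msuppD_le x y)).
rewrite (pmulw (fsubset_refl (msupp z)) (fsubsetUl _ (msupp y))).
rewrite (pmulw (fsubset_refl (msupp z)) (fsubsetUr (msupp x) _)).
rewrite -big_split; apply: eq_bigr => p _ /=.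
rewrite -big_split; apply: eq_bigr => q _ /=.
by rewrite mcoeffD mulrDr scalerDl.
Qed.

Lemma pmulZl c x y : pmul (c *: x) y = c *: pmul x y.
Proof.
rewrite (pmulw (msuppZ_le c x) (fsubset_refl (msupp y))) scaler_sumr.
apply: eq_bigr => p _; rewrite scaler_sumr; apply: eq_bigr => q _.
by rewrite mcoeffZ scalerA mulrA.
Qed.

Lemma pmulZr c x y : pmul x (c *: y) = c *: pmul x y.
Proof.
rewrite (pmulw (fsubset_refl (msupp x)) (msuppZ_le c y)) scaler_sumr.
apply: eq_bigr => p _; rewrite scaler_sumr; apply: eq_bigr => q _.
by rewrite mcoeffZ scalerA mulrCA.
Qed.

Lemma pmul0x x : pmul 0 x = 0.
Proof. by rewrite -[0 in LHS](scale0r (0 : kpaths)) pmulZl scale0r. Qed.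

Lemma pmulx0 x : pmul x 0 = 0.
Proof. by rewrite -[0 in LHS](scale0r (0 : kpaths)) pmulZr scale0r. Qed.

Lemma pmul_suml I (s : seq I) (P : pred I) (F : I -> kpaths) x :
  pmul (\sum_(i <- s | P i) F i) x = \sum_(i <- s | P i) pmul (F i) x.
Proof. exact: (big_morph (pmul^~ x) (fun _ _ => pmulDl _ _ _) (pmul0x x)). Qed.

Lemma pmul_sumr I (s : seq I) (P : pred I) (F : I -> kpaths) x :
  pmul x (\sum_(i <- s | P i) F i) = \sum_(i <- s | P i) pmul x (F i).
Proof. exact: (big_morph (pmul x) (fun _ _ => pmulDr _ _ _) (pmulx0 x)). Qed.

Lemma pmul_vec p q : pmul (pvec p) (pvec q) = pmulb p q.
Proof.
rewrite (pmulw msuppU_le msuppU_le) !big_seq_fset1.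
by rewrite !mcoeff_pvec !eqxx mulr1 scale1r.
Qed.

Lemma pmul_vecA p q r :
  pmul (pvec p) (pmulb q r) = pmul (pmulb p q) (pvec r).
Proof.
transitivity (if obind (pcat p) (pcat q r) is Some s then pvec s else 0).
  rewrite {1}/pmulb; case: (pcat q r) => [s|] /=; last exact: pmulx0.
  exact: pmul_vec.
rewrite pcatA {1}/pmulb; case: (pcat p q) => [s|] /=; last by rewrite pmul0x.
exact: esym (pmul_vec _ _).
Qed.

Lemma pathAlg_ind (P : kpaths -> Prop) :
  P 0 -> (forall c p x, P x -> P (c *: pvec p + x)) -> forall x, P x.
Proof.
by move=> P0 PD x; rewrite [x]pathAlgE; elim/big_rec: _ => // p y _; exact: PD.
Qed.

Lemma pmulA : associative pmul.
Proof.
apply: (bilinear_assoc pathAlg_ind pmulDl pmulDr pmulZl pmulZr) => p q r.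
by move: (pmul_vecA p q r); rewrite -(pmul_vec q r) -(pmul_vec p q).
Qed.

Lemma pmul1x : left_id pone pmul.
Proof.
apply: (bilinear_ext pathAlg_ind (pmulDr pone) (fun c => pmulZr c pone)) => p.
rewrite /pone pmul_suml (bigD1 (psrc p)) //= big1 ?addr0 => [|a ne].
  by rewrite pmul_vec /pmulb pcat1p eqxx.
by rewrite pmul_vec /pmulb pcat1p (negPf ne).
Qed.

Lemma pmulx1 : right_id pone pmul.
Proof.
apply: (bilinear_ext pathAlg_ind (fun x y => pmulDl x y pone)
  (fun c x => pmulZl c x pone)) => p.
rewrite /pone pmul_sumr (bigD1 (ptgt p)) //= big1 ?addr0 => [|a ne].
  by rewrite pmul_vec /pmulb pcatp1 eqxx.
by rewrite pmul_vec /pmulb pcatp1 (negPf ne).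
Qed.

Lemma pmul_coeff0 x y p :
  (forall q r, pcat q r = Some p -> x@_q * y@_r = 0) -> (pmul x y)@_p = 0.
Proof.
move=> h; rewrite /pmul raddf_sum big1 // => q _; rewrite raddf_sum big1 // => r _.
rewrite /= mcoeffZ /pmulb; case E: (pcat q r) => [s|]; last by rewrite mcoeff0 mulr0.
rewrite mcoeff_pvec; case: eqP => [sp|]; last by rewrite mulr0.
by rewrite h ?mul0r // E sp.
Qed.

Lemma pone_coeff (a : G) : pone@_(triv_path a) = 1.
Proof.
rewrite /pone raddf_sum.
have h b : (pvec (triv_path b))@_(triv_path a) = (b == a)%:R.
  rewrite mcoeff_pvec; congr (_%:R : K); congr nat_of_bool.
  by apply/eqP/eqP => [[]|->].
rewrite (eq_bigr (fun b => (b == a)%:R)) => [|b _]; last exact: h.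
by rewrite (bigD1 a) //= eqxx big1 ?addr0 // => b /negPf ->.
Qed.

Lemma pone_neq0 : pone != 0.
Proof.
have [a _] := eq_bigmax (fun _ : G => 0%N) (vertex_gt0 G).
apply/eqP => /(congr1 (mcoeff (triv_path a))).
by rewrite pone_coeff mcoeff0; apply/eqP; rewrite oner_eq0.
Qed.

(* The path algebra of the double of G: finite K-linear combinations of
   paths. *)
Definition pathAlg : Type := {malg K[qpath G]}.
HB.instance Definition _ := GRing.Lmodule.on pathAlg.

HB.instance Definition _ := GRing.Zmodule_isNzRing.Build pathAlg
  pmulA pmul1x pmulx1 pmulDl pmulDr pone_neq0.
HB.instance Definition _ := GRing.Lmodule_isLalgebra.Build K pathAlg
  (fun a x y => esym (pmulZl a x y)).
HB.instance Definition _ := GRing.Lalgebra_isAlgebra.Build K pathAlg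
  (fun a x y => esym (pmulZr a x y)).

Definition path_piece (n : nat) : set pathAlg :=
  [set x | forall p, p \in msupp x -> plen p = n].

End PathAlgebra.

Section QuotientAlgebra.
Variables (K : fieldType) (A : algType K).

Definition two_sided_ideal (I : set A) : Prop :=
  [/\ I 0, forall x y, I x -> I y -> I (x + y),
      forall a x, I x -> I (a * x) & forall a x, I x -> I (x * a)].

Definition ideal_gen (S : set A) : set A :=
  [set x | forall I, two_sided_ideal I -> S `<=` I -> I x].

Lemma ideal_gen_ideal S : two_sided_ideal (ideal_gen S).
Proof.
split.
- by move=> I [].
- move=> x y Ix Iy I iI sI; case: (iI) => _ h _ _.
  by apply: h; [exact: Ix|exact: Iy].
- by move=> a x Ix I iI sI; case: (iI) => _ _ h _; apply: h; exact: Ix.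
- by move=> a x Ix I iI sI; case: (iI) => _ _ _ h; apply: h; exact: Ix.
Qed.

Variable S : set A.

Definition idealb (x : A) : bool := `[< ideal_gen S x >].

Lemma idealbMl a x : x \in idealb -> a * x \in idealb.
Proof.
case: (ideal_gen_ideal S) => _ _ h _.
by move=> /asboolP Ix; apply/asboolP; exact: h.
Qed.

Lemma idealbMr a x : x \in idealb -> x * a \in idealb.
Proof.
case: (ideal_gen_ideal S) => _ _ _ h.
by move=> /asboolP Ix; apply/asboolP; exact: h.
Qed.

Lemma idealb_zmod_closed : zmod_closed idealb.
Proof.
case: (ideal_gen_ideal S) => h0 hD hl _.
split=> [|x y /asboolP Ix /asboolP Iy]; apply/asboolP => //.
by apply: hD => //; rewrite -mulN1r; exact: hl.
Qed.

HB.instance Definition _ := GRing.isZmodClosed.Build A idealb idealb_zmod_closed.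
Definition gen_zmod : zmodClosed A := GRing.ZmodClosed.clone A idealb _.

(* The proof argument makes the quotient a nonzero ring, as required by
   [algType]. *)
Definition quotAlg (_ : ~ ideal_gen S 1) : Type := {quot gen_zmod}.

Variable properS : ~ ideal_gen S 1.
Local Notation Q := (quotAlg properS).
HB.instance Definition _ := GRing.Zmodule.on Q.

Definition qproj (x : A) : Q := \pi_{quot gen_zmod} x.
Definition qrepr (x : Q) : A := repr (x : {quot gen_zmod}).

Lemma qreprK : cancel qrepr qproj. Proof. exact: reprK. Qed.

Lemma qprojP x y : qproj x = qproj y <-> x - y \in idealb.
Proof.
by rewrite idealrBE; split => [e|/eqP e]; [apply/eqP|]; exact: e.
Qed.

Lemma qprojD x y : qproj (x + y) = qproj x + qproj y.
Proof. exact: (raddfD (\pi_{quot gen_zmod})). Qed.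

Definition qone : Q := qproj 1.
Definition qmul (x y : Q) : Q := qproj (qrepr x * qrepr y).
Definition qscale (a : K) (x : Q) : Q := qproj (a *: qrepr x).

Lemma qrepr_proj x : qrepr (qproj x) - x \in idealb.
Proof. by apply/qprojP; rewrite qreprK. Qed.

Lemma qprojM x y : qproj (x * y) = qmul (qproj x) (qproj y).
Proof.
apply/esym/qprojP; set x' := qrepr _; set y' := qrepr _.
have -> : x' * y' - x * y = (x' - x) * y' + x * (y' - y).
  by rewrite mulrBl mulrBr addrA subrK.
by apply: rpredD; [apply: idealbMr|apply: idealbMl]; exact: qrepr_proj.
Qed.

Lemma qprojZ a x : qproj (a *: x) = qscale a (qproj x).
Proof.
apply/esym/qprojP; rewrite -scalerBr -[_ - _]mul1r scalerAl.
by apply: idealbMl; exact: qrepr_proj.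
Qed.

Lemma qind (P : Q -> Prop) : (forall x, P (qproj x)) -> forall x, P x.
Proof. by move=> h x; rewrite -[x]qreprK. Qed.

Lemma qmulA : associative qmul.
Proof.
by elim/qind=> x; elim/qind=> y; elim/qind=> z; rewrite -!qprojM mulrA.
Qed.
Lemma qmul1x : left_id qone qmul.
Proof. by elim/qind=> x; rewrite -qprojM mul1r. Qed.
Lemma qmulx1 : right_id qone qmul.
Proof. by elim/qind=> x; rewrite -qprojM mulr1. Qed.
Lemma qmulDl : left_distributive qmul +%R.
Proof.
elim/qind=> x; elim/qind=> y; elim/qind=> z.
by rewrite -qprojD -!qprojM -qprojD mulrDl.
Qed.
Lemma qmulDr : right_distributive qmul +%R.
Proof.
elim/qind=> x; elim/qind=> y; elim/qind=> z.
by rewrite -qprojD -!qprojM -qprojD mulrDr.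
Qed.
Lemma qone_neq0 : qone != 0.
Proof.
have e0 : qproj 0 = 0 by exact: (raddf0 (\pi_{quot gen_zmod})).
by apply/eqP; rewrite -e0 => /qprojP; rewrite subr0 => /asboolP.
Qed.
HB.instance Definition _ := GRing.Zmodule_isNzRing.Build Q
  qmulA qmul1x qmulx1 qmulDl qmulDr qone_neq0.

Lemma qscaleA a b x : qscale a (qscale b x) = qscale (a * b) x.
Proof. by elim/qind: x => x; rewrite -!qprojZ scalerA. Qed.
Lemma qscale1 : left_id 1 qscale.
Proof. by elim/qind=> x; rewrite -qprojZ scale1r. Qed.
Lemma qscaleDr : right_distributive qscale +%R.
Proof.
move=> a; elim/qind=> x; elim/qind=> y.
by rewrite -qprojD -!qprojZ -qprojD scalerDr.
Qed.
Lemma qscaleDl x : {morph qscale^~ x : a b / a + b}.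
Proof. by move=> a b; elim/qind: x => x; rewrite -!qprojZ -qprojD scalerDl. Qed.
HB.instance Definition _ := GRing.Zmodule_isLmodule.Build K Q
  qscaleA qscale1 qscaleDr qscaleDl.

Lemma qscaleAl a (x y : Q) : a *: (x * y) = (a *: x) * y.
Proof.
elim/qind: x => x; elim/qind: y => y.
by rewrite /GRing.scale/GRing.mul/= -!(qprojM, qprojZ) scalerAl.
Qed.
Lemma qscaleAr a (x y : Q) : a *: (x * y) = x * (a *: y).
Proof.
elim/qind: x => x; elim/qind: y => y.
by rewrite /GRing.scale/GRing.mul/= -!(qprojM, qprojZ) scalerAr.
Qed.
HB.instance Definition _ := GRing.Lmodule_isLalgebra.Build K Q qscaleAl.
HB.instance Definition _ := GRing.Lalgebra_isAlgebra.Build K Q qscaleAr.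

End QuotientAlgebra.

Section GradedSymmetric.
Variable K : fieldType.

(* An algebra with a family of subsets as candidate homogeneous components;
   that they form a grading is expressed by [is_grading]. *)
Record pregradedAlg := PregradedAlg {
  galg :> algType K;
  piece : nat -> set galg }.
Arguments piece : clear implicits.

Definition is_subspace (A : algType K) (V : set A) : Prop :=
  V 0 /\ forall a x y, V x -> V y -> V (a *: x + y).

Definition is_grading (A : algType K) (V : nat -> set A) : Prop :=
  [/\ forall n, is_subspace (V n),
      V 0%N 1,
      forall m n x y, V m x -> V n y -> V (m + n)%N (x * y),
      forall x, exists N (f : nat -> A),
        (forall n, V n (f n)) /\ x = \sum_(n < N) f n
    & forall N (f : nat -> A), (forall n, V n (f n)) ->
        \sum_(n < N) f n = 0 -> forall n, (n < N)%N -> f n = 0].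

Definition finite_dimensional (A : algType K) : Prop :=
  exists n, inhabited (Vector.axiom n A).

(* Nondegeneracy on one side suffices, as the form is symmetric. *)
Definition symmetrizing_trace (A : algType K) (tr : {scalar A}) : Prop :=
  (forall x y, tr (x * y) = tr (y * x)) /\
  (forall x, (forall y, tr (x * y) = 0) -> x = 0).

(* A trace A -> K is homogeneous of degree k if it sends the component of
   degree n to that of degree n + k of K, where K is concentrated in
   degree 0. *)
Definition homogeneous_trace (A : pregradedAlg) (tr : {scalar A}) (k : int) :
    Prop :=
  forall n x, piece A n x -> n%:Z + k != 0 -> tr x = 0.

Definition graded_symmetric (A : pregradedAlg) : Prop :=
  [/\ finite_dimensional A, is_grading (piece A)
    & exists tr : {scalar A}, symmetrizing_trace tr /\
        exists k, homogeneous_trace tr k].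

End GradedSymmetric.
Arguments piece {K} p n.

Section Zigzag.
Variables (K : fieldType) (G : connGraph).

Definition long_paths : set (pathAlg K G) :=
  [set pvec K p | p in [set p : qpath G | (2 < plen p)%N]].

(* Here [p : qpath G] already enforces that consecutive vertices are
   adjacent. *)
Definition straight_paths : set (pathAlg K G) :=
  [set x | exists (p : qpath G) (a b c : G),
     [/\ val p = (a, [:: b; c]), a != c & x = pvec K p]].

Definition loop_differences : set (pathAlg K G) :=
  [set x | exists (p q : qpath G) (a b c : G),
     [/\ val p = (a, [:: b; a]), val q = (a, [:: c; a])
       & x = pvec K p - pvec K q]].

Definition zigzag_rel : set (pathAlg K G) :=
  if #|G| == 2%N then long_paths else straight_paths `|` loop_differences.

Lemma positive_ideal :
  two_sided_ideal
    [set x : pathAlg K G | forall p : qpath G, plen p = 0%N -> x@_p = 0].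
Proof.
split=> [p _|x y hx hy p p0|a x hx p p0|a x hx p p0] /=.
- by rewrite mcoeff0.
- by rewrite mcoeffD hx // hy // addr0.
- apply: pmul_coeff0 => q r E; rewrite hx ?mulr0 //.
  by move: (pcat_len E); rewrite p0 => /esym/eqP; rewrite addn_eq0; case/andP => /eqP q0 /eqP r0.
- apply: pmul_coeff0 => q r E; rewrite hx ?mul0r //.
  by move: (pcat_len E); rewrite p0 => /esym/eqP; rewrite addn_eq0; case/andP => /eqP q0 /eqP r0.
Qed.

Lemma zigzag_proper : ~ ideal_gen zigzag_rel 1.
Proof.
have [a _] := eq_bigmax (fun _ : G => 0%N) (vertex_gt0 G).
have vec0 (p q : qpath G) : (0 < plen p)%N -> plen q = 0%N ->
    (pvec K p)@_q = 0.
  by move=> p0 q0; rewrite mcoeff_pvec; case: eqP => // e; rewrite e q0 in p0.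
move=> /(_ _ positive_ideal) h.
suff /h /(_ (triv_path a) erefl) : zigzag_rel `<=`
    [set x : pathAlg K G | forall p : qpath G, plen p = 0%N -> x@_p = 0].
  by rewrite [1]/(pone K G) pone_coeff; apply/eqP; rewrite oner_eq0.
rewrite /zigzag_rel; case: ifP => _ x.
  by move=> [p /= p2 <-] q; apply: vec0; exact: leq_trans p2.
case=> [[p [b [c [d [e _ ->]]]]] q|[p [p' [b [c [d [e e' ->]]]]]] q] q0 /=.
  by apply: vec0; rewrite // /plen e.
have h1 : (pvec K p)@_q = 0 by apply: vec0; rewrite // /plen e.
have h2 : (pvec K p')@_q = 0 by apply: vec0; rewrite // /plen e'.
exact: etrans (mcoeffB q (pvec K p) (pvec K p'))
  (etrans (congr2 (fun a b => a - b) h1 h2) (subr0 0)).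
Qed.

Definition zigzag_quot : pregradedAlg K :=
  PregradedAlg (galg := quotAlg zigzag_proper)
    (fun n => [set qproj zigzag_proper x | x in path_piece n]).

(* K[X]/(X^2) with X in degree 2. *)
Definition dual_numbers : pregradedAlg K :=
  PregradedAlg (galg := {poly %/ ('X^2 : {poly K})})
    (fun n => [set x : {poly %/ ('X^2 : {poly K})} |
       forall i : nat, (2 * i)%N != n -> (x : {poly K})`_i = 0]).

Definition zigzag : pregradedAlg K :=
  if #|G| == 1%N then dual_numbers else zigzag_quot.

End Zigzag.

(* Main.v *)
From HB Require Import structures.
Require Import Defs.
From mathcomp Require Import all_boot all_algebra reals complex.
From mathcomp Require Import finmap monalg boolp classical_sets zify.

(** The symmetrizing trace of a zigzag algebra reads off the coefficients of
    the closed paths of length two: every vertex [a] carries, modulo the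
    relations, exactly one class of loops (a|b|a), and the trace is the sum of
    the coordinates on these classes.  The proof has to show that the quotient
    by the ideal of relations is as large as it should be, so that this trace
    is well defined and nondegenerate.

    The device is the _type_ (source, target, length) of a path.  The path
    algebra maps to the matrices over [K[T]] indexed by the vertices, a path
    [p] going to [T ^ (length p)] placed at the entry (source, target).  The
    coefficients of this representation are the functionals [mass t], where
    [mass t x] is the sum of the coefficients of [x] on the paths of type [t].
    Call a type live if its length is at most one, or if it is closed of length
    two.  Then the ideal of zigzag relations is exactly the common kernel of
    the functionals [mass t] for live [t]:
    - the common kernel is a two-sided ideal ([mass_zero_ideal]), since the
      mass of a product with a path is again a mass ([mass_pvecMl],
      [mass_pvecMr]), and it contains the relations;
    - conversely, a path of non-live type lies in the ideal
      ([dead_path_in_ideal]) and two paths of the same live type are congruent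
      ([live_paths_congr]), so that an element is determined modulo the ideal
      by its live masses ([normal_form]).

    Choosing one path of each live type that occurs gives a basis of the
    quotient whose dual basis consists of masses; as masses are homogeneous
    for the length of paths, this proves that the quotient is finite
    dimensional and graded.  The trace is the sum of the masses of the closed
    types of length two, that is, the [T ^ 2] coefficient of the matrix trace,
    whence its symmetry.  Multiplying [x] by a path from [b] to [a] of length
    [2 - n] and taking the trace gives the mass of [x] at the type (a, b, n).
    In a connected graph with at least two vertices such a complementary path
    exists for every live type that occurs ([complementary_path]), so an
    element orthogonal to everything has all its live masses zero and vanishes.

    The graph with one vertex is separate: its algebra consists of the dual
    numbers, with the coefficient of [X] as trace. *)

Set Implicit Arguments.
Unset Strict Implicit.
Unset Printing Implicit Defensive.

Import GRing.Theory.
Local Open Scope ring_scope.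

(** * Dual bases and linear forms *)

Lemma scalar_lincomb (K : fieldType) (V : lmodType K) (f : {scalar V})
    (c : K) (u u' v v' : V) :
  f u = f u' -> f v = f v' -> f (c *: u + v) = f (c *: u' + v').
Proof. by move=> fu fv; rewrite !linearP /= fu fv. Qed.

Lemma scalar_lincomb0 (K : fieldType) (V : lmodType K) (f : {scalar V})
    (c : K) (u v : V) : f u = 0 -> f v = 0 -> f (c *: u + v) = 0.
Proof. by move=> fu fv; rewrite linearP fu fv addr0 mulr0. Qed.

Lemma residue_linear (K : fieldType) (V : lmodType K) (B : finType)
    (f : B -> {scalar V}) (w : B -> V) :
  linear (fun u => u - \sum_i f i u *: w i).
Proof.
move=> c u v; under eq_bigr => i _ do rewrite linearP scalerDl -scalerA.
by rewrite big_split -scaler_sumr opprD addrACA -scalerBr.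
Qed.

Lemma dual_basis_coord (K : fieldType) (V : lmodType K) (B : finType)
    (f : B -> {scalar V}) (v : B -> V) (r : B -> K) j :
  (forall i k, f i (v k) = (i == k)%:R) ->
  f j (\sum_i r i *: v i) = r j.
Proof.
move=> fv; rewrite linear_sum (bigD1 j) //= big1 => [|i ne].
  by rewrite linearZ /= fv eqxx mulr1 addr0.
by rewrite linearZ /= fv eq_sym (negPf ne) mulr0.
Qed.

Lemma dual_basis_expansion (K : fieldType) (V : lmodType K) (B : finType)
    (f : B -> {scalar V}) (v : B -> V) :
  (forall i j, f i (v j) = (i == j)%:R) ->
  (forall x, (forall i, f i x = 0) -> x = 0) ->
  forall x, x = \sum_i f i x *: v i.
Proof.
move=> fv finj x; apply/eqP; rewrite -subr_eq0; apply/eqP/finj => i.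
by rewrite linearB (dual_basis_coord _ _ fv) subrr.
Qed.

Lemma dual_basis_finite_dimensional (K : fieldType) (A : algType K)
    (B : finType) (c : B -> {scalar A}) (v : B -> A) :
  (forall i j, c i (v j) = (i == j)%:R) ->
  (forall x, (forall i, c i x = 0) -> x = 0) -> finite_dimensional A.
Proof.
move=> cv cinj; exists #|B|; constructor.
exists (fun x : A => \row_j c (enum_val j) x).
  by move=> a x y; apply/rowP => j; rewrite !mxE linearP.
exists (fun r : 'rV[K]_#|B| => \sum_i r 0 (enum_rank i) *: v i) => [x|r].
  rewrite [RHS](dual_basis_expansion cv cinj).
  by apply: eq_bigr => i _; rewrite mxE enum_rankK.
by apply/rowP => j; rewrite mxE (dual_basis_coord _ _ cv) enum_valK.
Qed.

(** * Quotients by a generated ideal *)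

Section IdealQuotient.
Variables (K : fieldType) (A : algType K) (S : set A).

Lemma ideal_gen_sub x : S x -> ideal_gen S x.
Proof. by move=> Sx I _; exact. Qed.

Lemma ideal_genMl a x : ideal_gen S x -> ideal_gen S (a * x).
Proof. by case: (ideal_gen_ideal S) => _ _ h _; exact: h. Qed.

Lemma ideal_genMr a x : ideal_gen S x -> ideal_gen S (x * a).
Proof. by case: (ideal_gen_ideal S) => _ _ _; exact. Qed.

Lemma ideal_gen_linear c x y :
  ideal_gen S x -> ideal_gen S y -> ideal_gen S (c *: x + y).
Proof.
move=> Ix; case: (ideal_gen_ideal S) => _ h _ _; apply: h.
by rewrite -[x]mul1r scalerAl; exact: ideal_genMl.
Qed.

Lemma ideal_gen0 : ideal_gen S 0.
Proof. by case: (ideal_gen_ideal S). Qed.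

Lemma ideal_gen_congr x y :
  ideal_gen S (x - y) -> ideal_gen S y -> ideal_gen S x.
Proof.
move=> Ixy Iy; rewrite -[x](subrK y) -[X in X + _]scale1r.
exact: ideal_gen_linear.
Qed.

Variable properS : ~ ideal_gen S 1.
Local Notation Q := (quotAlg properS).
Local Notation pi := (qproj properS).

Lemma qproj_eq x y : pi x = pi y <-> ideal_gen S (x - y).
Proof. by rewrite qprojP; split=> /asboolP. Qed.

Lemma qproj_linear : linear (pi : A -> Q).
Proof. by move=> a x y; rewrite qprojD qprojZ. Qed.
HB.instance Definition _ := GRing.isLinear.Build K A Q *:%R pi qproj_linear.

Lemma qproj_eq0 x : pi x = 0 <-> ideal_gen S x.
Proof. by rewrite -(linear0 pi) qproj_eq subr0. Qed.

Lemma qproj_mul x y : pi (x * y) = pi x * pi y.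
Proof. exact: qprojM. Qed.

(** Returned as a witness in [Type], so that a whole family of forms can be
    pushed down to the quotient at once. *)
Lemma scalar_descends (f : {scalar A}) :
  (forall x, ideal_gen S x -> f x = 0) ->
  {g : {scalar Q} | forall x, g (pi x) = f x}.
Proof.
move=> f0; pose g (x : Q) := f (qrepr x).
have gE x : g (pi x) = f x.
  apply/eqP; rewrite -subr_eq0 -linearB; apply/eqP/f0.
  by have /asboolP := qrepr_proj properS x.
have glin : linear_for *%R g.
  move=> a x y; elim/qind: x => x; elim/qind: y => y.
  by rewrite -linearP !gE linearP.
pose gL := GRing.isLinear.Build K Q K *%R g glin.
pose h : {scalar Q} := HB.pack g gL.
by exists h.
Qed.

End IdealQuotient.

(** * Linear forms on the path algebra *)

Section LinearExtension.
Variables (K : fieldType) (G : connGraph).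
Implicit Types (w : qpath G -> K) (x y : pathAlg K G) (p q r : qpath G).

Definition lext w x : K := \sum_(p <- msupp x) x@_p * w p.

(** The support of a sum is only contained in the union of the supports;
    enlarging the range of summation is what makes linearity a termwise
    computation. *)
Lemma lextw w (d : {fset qpath G}) x :
  (msupp x `<=` d)%fset -> lext w x = \sum_(p <- d) x@_p * w p.
Proof.
move=> le; rewrite /lext (big_fset_incl _ le) // => p _ /mcoeff_outdom ->.
by rewrite mul0r.
Qed.

Lemma lext_linear w : linear_for *%R (lext w : pathAlg K G -> K).
Proof.
move=> c x y.
pose d := (msupp x `|` msupp y)%fset.
have le : (msupp (c *: x + y) `<=` d)%fset.
  apply: fsubset_trans (msuppD_le _ _) _.
  by apply: fsetSU; exact: msuppZ_le.
rewrite (lextw w le) (lextw w (fsubsetUl _ _ : (msupp x `<=` d)%fset)).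
rewrite (lextw w (fsubsetUr _ _ : (msupp y `<=` d)%fset)).
rewrite mulr_sumr -big_split; apply: eq_bigr => p _ /=.
rewrite [X in X * _](_ : _ = c * x@_p + y@_p) ?mulrDl ?mulrA //.
exact: etrans (mcoeffD p _ _) (congr1 (fun a => a + _) (mcoeffZ c x p)).
Qed.
HB.instance Definition _ w :=
  GRing.isLinear.Build K (pathAlg K G) K *%R (lext w) (lext_linear w).

Lemma lext_pvec w p : lext w (pvec K p) = w p.
Proof.
by rewrite (lextw w msuppU_le) big_seq_fset1 mcoeff_pvec eqxx mul1r.
Qed.

End LinearExtension.

(** * Types of paths *)

Section PathTypes.
Variable G : connGraph.
Implicit Types (a b c : G) (p q r : qpath G).

Definition ptype p : (G * G) * nat := (psrc p, ptgt p, plen p).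

(** The types that survive in the zigzag algebra: those of vertices, of arrows
    and of loops of length two.  A live type need not be the type of a path. *)
Definition live (t : (G * G) * nat) : bool :=
  (t.2 < 2)%N || (t.2 == 2%N) && (t.1.1 == t.1.2).

Lemma live_lt3 t : live t -> (t.2 < 3)%N.
Proof. by case/orP => [/ltnW|/andP[/eqP ->]]. Qed.

Lemma qpath_val a s : path adj a s -> {p : qpath G | val p = (a, s)}.
Proof.
by move=> h; exists (exist (fun u : G * seq G => path adj u.1 u.2) (a, s) h).
Qed.

Lemma plen0_triv p : plen p = 0%N -> p = triv_path (psrc p).
Proof.
move=> p0; apply: val_inj; rewrite [LHS]surjective_pairing /=.
by move: p0; rewrite /plen; case: (val p).2.
Qed.

Lemma adj_neq a b : adj a b -> a != b.
Proof. by apply: contraTneq => ->; rewrite adj_irrefl. Qed.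

(** A path joining the inside of [D] to its outside has a first edge that
    leaves [D]; connectedness of the graph enters the proof only here. *)
Lemma boundary_edge (D : {pred G}) a b :
  a \in D -> b \notin D -> exists2 c, c \in D & exists2 d, d \notin D & adj c d.
Proof.
move=> aD bD; have /connectP[s] := adj_connected a b.
elim: s a aD => [a aD _ eb|c s IHs a aD /= /andP[ac cs] eb].
  by rewrite eb aD in bD.
case cD: (c \in D); first exact: IHs cs eb.
by exists a => //; exists c; rewrite ?cD.
Qed.

Lemma neighbour_exists a : #|G| != 1%N -> exists b, adj a b.
Proof.
move=> G1.
have [/existsP[b ba]|/existsPn h] := boolP [exists b, b \notin pred1 a].
  have aa : a \in pred1 a by exact: eqxx.
  by have [c /eqP -> [d _ ad]] := boundary_edge aa ba; exists d.
case/eqP: G1; rewrite -(card1 a); apply: eq_card => b.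
by rewrite -[RHS]negbK (negPf (h b)) //; case: eqP.
Qed.

End PathTypes.

(** * Masses and the trace of the path algebra *)

Section PathMass.
Variables (K : fieldType) (G : connGraph).
Implicit Types (p q r : qpath G) (x y : pathAlg K G) (t : (G * G) * nat).

Local Notation "[ 'vec' p ]" := (pvec K p : pathAlg K G) (at level 0).

Definition mass t : {scalar pathAlg K G} := lext (fun p => (ptype p == t)%:R).

Lemma mass_pvec t p : mass t [vec p] = (ptype p == t)%:R.
Proof. exact: lext_pvec. Qed.

Lemma mass_unoccupied t x : (forall p, ptype p <> t) -> mass t x = 0.
Proof.
move=> ht; rewrite [LHS]big1 // => p _.
by rewrite (introF eqP (ht p)) mulr0.
Qed.

Lemma pvecM p q : [vec p] * [vec q] = pmulb K p q.
Proof. exact: pmul_vec. Qed.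

Lemma lext_pmulb (w : qpath G -> K) (f : (G * G) * nat -> K) p q :
  (forall r, w r = f (ptype r)) ->
  lext w (pmulb K p q) =
  if ptgt p == psrc q then f (psrc p, ptgt q, (plen p + plen q)%N) else 0.
Proof.
move=> wf; rewrite /pmulb; case E: (pcat p q) => [r|].
  rewrite lext_pvec wf /ptype (pcat_src E) (pcat_tgt E) (pcat_len E).
  by case: pcatP E => // _ -> _ _; rewrite eqxx.
by rewrite linear0; case: pcatP E => // /eqP/negPf ->.
Qed.

Lemma mass_pmulb t p q :
  mass t (pmulb K p q) =
  ((ptgt p == psrc q) && ((psrc p, ptgt q, (plen p + plen q)%N) == t))%:R.
Proof.
rewrite [LHS](lext_pmulb (f := fun u => (u == t)%:R)) //.
by case: eqP.
Qed.

(** Reading the entry (a, b) in degree [n] of a product of matrices whose left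
    factor is a monomial matrix unit: only the entry (target of [p], b) of the
    right factor contributes. *)
Lemma mass_pvecMl a b n p x :
  mass (a, b, n) ([vec p] * x) =
  if (psrc p == a) && (plen p <= n)%N then mass (ptgt p, b, (n - plen p)%N) x
  else 0.
Proof.
elim/pathAlg_ind: x => [|c q x IHx]; first by rewrite mulr0 !linear0 if_same.
rewrite mulrDr -scalerAr pvecM !linearP /= {}IHx.
rewrite mass_pmulb mass_pvec !xpair_eqE.
rewrite (eq_sym (psrc q)).
case: (psrc p == a); rewrite /= ?andbF ?mulr0 ?addr0 //.
case: leqP => [le|lt]; last by rewrite gtn_eqF ?andbF ?mulr0 ?addr0 // ltn_addr.
by rewrite andbA -(eqn_add2l (plen p) (plen q)) subnKC.
Qed.

Lemma mass_pvecMr a b n p x :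
  mass (a, b, n) (x * [vec p]) =
  if (ptgt p == b) && (plen p <= n)%N then mass (a, psrc p, (n - plen p)%N) x
  else 0.
Proof.
elim/pathAlg_ind: x => [|c q x IHx]; first by rewrite mul0r !linear0 if_same.
rewrite mulrDl -scalerAl pvecM !linearP /= {}IHx.
rewrite mass_pmulb mass_pvec !xpair_eqE.
rewrite (addnC (plen q)).
case: (ptgt p == b); rewrite /= ?andbF ?mulr0 ?addr0 //.
case: leqP => [le|lt]; last by rewrite gtn_eqF ?andbF ?mulr0 ?addr0 // ltn_addr.
rewrite -(eqn_add2l (plen p) (plen q)) subnKC // andbT.
by rewrite andbA (andbC (_ == psrc p)).
Qed.

(** The [T ^ 2] coefficient of the trace of the matrix of an element. *)
Definition ptrace : {scalar pathAlg K G} :=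
  lext (fun p => ((psrc p == ptgt p) && (plen p == 2%N))%:R).

Lemma ptrace_mass x : ptrace x = \sum_(a : G) mass (a, a, 2%N) x.
Proof.
elim/pathAlg_ind: x => [|c p x IHx].
  by rewrite linear0 big1 // => a _; rewrite linear0.
rewrite linearP /= IHx.
under [RHS]eq_bigr => a _ do rewrite linearP /=.
rewrite big_split -mulr_sumr /=; congr (_ * _ + _).
rewrite lext_pvec (bigD1 (psrc p)) //= big1 => [|a ne].
  by rewrite mass_pvec !xpair_eqE eqxx /= addr0 eq_sym.
by rewrite mass_pvec !xpair_eqE eq_sym (negPf ne).
Qed.

(** Pairing with a path isolates a single mass; nondegeneracy of the trace
    rests on this formula. *)
Lemma ptrace_pvecMr p x : (plen p <= 2)%N ->
  ptrace (x * [vec p]) = mass (ptgt p, psrc p, (2 - plen p)%N) x.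
Proof.
move=> p2; rewrite ptrace_mass (bigD1 (ptgt p)) //= big1 => [|a ne].
  by rewrite mass_pvecMr eqxx p2 addr0.
by rewrite mass_pvecMr eq_sym (negPf ne).
Qed.

(** On two paths both sides count the same closed composites: [p] followed by
    [q] is a closed path of length two exactly when [q] followed by [p] is. *)
Lemma ptraceC x y : ptrace (x * y) = ptrace (y * x).
Proof.
elim/pathAlg_ind: x => [|c p x IHx]; first by rewrite mul0r mulr0.
rewrite mulrDl mulrDr -scalerAl -scalerAr; apply: scalar_lincomb IHx.
elim/pathAlg_ind: y => [|d q y IHy]; first by rewrite mul0r mulr0.
rewrite [in LHS]mulrDr [in RHS]mulrDl -[in LHS]scalerAr -[in RHS]scalerAl.
apply: scalar_lincomb IHy.
pose f (t : (G * G) * nat) : K := ((t.1.1 == t.1.2) && (t.2 == 2%N))%:R.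
rewrite [in LHS]pvecM [in RHS]pvecM.
rewrite [LHS](lext_pmulb (f := f)) // [RHS](lext_pmulb (f := f)) //.
rewrite /f /= addnC (eq_sym (psrc p)) (eq_sym (psrc q)).
by case: (ptgt q == _); case: (ptgt p == _).
Qed.

End PathMass.

(** * The ideal of zigzag relations *)

Section ZigzagIdeal.
Variables (K : fieldType) (G : connGraph).
Implicit Types (a b c d : G) (p q r : qpath G) (x y : pathAlg K G).
Implicit Types (t : (G * G) * nat).

Local Notation "[ 'vec' p ]" := (pvec K p : pathAlg K G) (at level 0).
Local Notation zz_ideal := (ideal_gen (@zigzag_rel K G)).

(** Total version of [pvec], with value 0 on a list of vertices that is not a
    path.  It makes concatenation an unconditional identity
    ([walk_vec_cat]), so that relations can be inserted anywhere in a path. *)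
Definition walk_vec a (s : seq G) : pathAlg K G :=
  if insub (a, s) is Some p then pvec K (p : qpath G) else 0.

Variant walk_vec_spec a s : pathAlg K G -> Prop :=
| WalkPath p of path adj a s & val p = (a, s) : walk_vec_spec a s [vec p]
| WalkNone of ~~ path adj a s : walk_vec_spec a s 0.

Lemma walk_vecP a s : walk_vec_spec a s (walk_vec a s).
Proof. by rewrite /walk_vec; case: insubP => [p|]; constructor. Qed.

Lemma walk_vec_val p a s : val p = (a, s) -> walk_vec a s = [vec p].
Proof.
move=> vp; have h : path adj a s by have := valP p; rewrite vp.
by case: walk_vecP => [q _ vq|/negP//]; congr pvec; apply: val_inj; rewrite vp.
Qed.

Lemma walk_vec_cat a s s' :
  walk_vec a (s ++ s') = walk_vec a s * walk_vec (last a s) s'.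
Proof.
case: (walk_vecP a s) => [p ps vp|nps]; last first.
  rewrite mul0r; case: walk_vecP => // r.
  by rewrite cat_path (negPf nps).
case: (walk_vecP (last a s) s') => [q qs vq|nqs]; last first.
  rewrite mulr0; case: walk_vecP => // r.
  by rewrite cat_path (negPf nqs) andbF.
rewrite [RHS]pvecM /pmulb; case: pcatP => [r _ vr|[]].
  by apply: walk_vec_val; rewrite vr /psrc vp vq.
by rewrite /ptgt /psrc vp vq.
Qed.

Lemma card2_mem a b c : #|G| = 2%N -> a != b -> (c == a) || (c == b).
Proof.
move=> G2 ab.
have: [set: G] = [set a; b].
  by apply/esym/eqP; rewrite eqEcard finset.subsetT cards2 ab cardsT G2.
by move/setP/(_ c); rewrite !inE.
Qed.

Lemma vertex_outside a b :
  #|G| != 2%N -> a != b -> exists c, c \notin [set a; b].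
Proof.
move=> G2 ab; apply/existsP; apply: contraNT G2 => /existsPn h.
rewrite -cardsT; have -> : [set: G] = [set a; b].
  by apply/setP => c; rewrite inE (negbNE (h c)).
by rewrite cards2 ab.
Qed.

(** With two vertices only, nothing has to be done: (a|b|c) with [a != c]
    cannot be a path. *)
Lemma straight_in_ideal a b c : a != c -> zz_ideal (walk_vec a [:: b; c]).
Proof.
move=> ac; case: walk_vecP => [p|]; last by move=> _; exact: ideal_gen0.
move=> /and3P[ab bc _] vp; apply: ideal_gen_sub; rewrite /zigzag_rel.
case: eqP => G2; last by left; exists p, a, b, c.
have := card2_mem c G2 (adj_neq ab).
by rewrite eq_sym (negPf ac) eq_sym (negPf (adj_neq bc)).
Qed.

(** With two vertices only, [b] and [c] must be the same vertex. *)
Lemma loop_difference_in_ideal a b c : adj a b -> adj a c ->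
  zz_ideal (walk_vec a [:: b; a] - walk_vec a [:: c; a]).
Proof.
move=> ab ac; case: (boolP (#|G| == 2%N)) => [/eqP G2|G2].
  have := card2_mem c G2 (adj_neq ab).
  rewrite eq_sym (negPf (adj_neq ac)) => /eqP ->.
  by rewrite subrr; exact: ideal_gen0.
case: walk_vecP => [p _ vp|]; last by rewrite /= ab adj_sym ab.
case: walk_vecP => [q _ vq|]; last by rewrite /= ac adj_sym ac.
apply: ideal_gen_sub; rewrite /zigzag_rel (negPf G2).
by right; exists p, q, a, b, c.
Qed.

(** By the straight relations only (a|b|a|b) is in question.  If the graph has
    a third vertex, connectedness provides an edge from [a] or from [b] to
    some other vertex [w].  Exchanging one of the two overlapping loops for
    the loop through [w] yields (a|w|a|b) or (a|b|w|b), and each of them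
    contains a straight path. *)
Lemma length3_in_ideal a b c d : zz_ideal (walk_vec a [:: b; c; d]).
Proof.
have [ac|nac] := eqVneq a c; last first.
  rewrite -[X in walk_vec _ X]/([:: b; c] ++ [:: d]) walk_vec_cat.
  by apply: ideal_genMr; apply: straight_in_ideal.
have [bd|nbd] := eqVneq b d; last first.
  rewrite -[X in walk_vec _ X]/([:: b] ++ [:: c; d]) walk_vec_cat.
  by apply: ideal_genMl; apply: straight_in_ideal.
rewrite -{c}ac -{d}bd.
case: (walk_vecP a [:: b; a; b]) => [p /and4P[ab ba _ _] vp|_]; last first.
  exact: ideal_gen0.
have [G2|G2] := boolP (#|G| == 2%N).
  apply: ideal_gen_sub; rewrite /zigzag_rel G2; exists p => //=.
  by rewrite /plen vp.
rewrite -(walk_vec_val vp).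
have [z zab] := vertex_outside G2 (adj_neq ab).
have aab : a \in [set a; b] by rewrite !inE eqxx.
have [u uab [w wab uw]] := boundary_edge aab zab.
move: uab wab uw; rewrite !inE negb_or => /orP[] /eqP -> /andP[wa wb] uw.
- apply: (ideal_gen_congr (y := walk_vec a [:: w; a; b])).
    rewrite (walk_vec_cat a [:: b; a] [:: b]) (walk_vec_cat a [:: w; a] [:: b]).
    by rewrite -mulrBl; apply: ideal_genMr; apply: loop_difference_in_ideal.
  rewrite (walk_vec_cat a [:: w] [:: a; b]).
  by apply: ideal_genMl; apply: straight_in_ideal.
- apply: (ideal_gen_congr (y := walk_vec a [:: b; w; b])).
    rewrite (walk_vec_cat a [:: b] [:: a; b]) (walk_vec_cat a [:: b] [:: w; b]).
    by rewrite -mulrBr; apply: ideal_genMl; apply: loop_difference_in_ideal.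
  rewrite (walk_vec_cat a [:: b; w] [:: b]).
  by apply: ideal_genMr; apply: straight_in_ideal; rewrite eq_sym.
Qed.

(** A path of length at least three has an initial segment of length three,
    and an open path of length two is straight. *)
Lemma dead_path_in_ideal p : ~~ live (ptype p) -> zz_ideal [vec p].
Proof.
case E: (val p) => [a s].
rewrite -(walk_vec_val E) /live /ptype /psrc /ptgt /plen E /=.
case: s {E} => [|b [|c [|d s]]] //= h.
  exact: straight_in_ideal.
rewrite (walk_vec_cat a [:: b; c; d] s).
by apply: ideal_genMr; apply: length3_in_ideal.
Qed.

(** Paths of length at most one are determined by their endpoints, and closed
    paths of length two are identified by the loop relations. *)
Lemma live_paths_congr p q :
  live (ptype p) -> ptype p = ptype q -> zz_ideal ([vec p] - [vec q]).
Proof.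
case Ep: (val p) => [a s]; case Eq: (val q) => [a' s'].
rewrite -(walk_vec_val Ep) -(walk_vec_val Eq).
have := valP p; have := valP q.
rewrite /live /ptype /psrc /ptgt /plen Ep Eq /= => adj_s' adj_s lp [ea et es].
move: lp et es adj_s adj_s'; rewrite -{}ea {p q Ep Eq}.
case: s => [|b [|c [|? ?]]] //=; case: s' => [|b' [|c' [|? ?]]] //=.
- by move=> *; rewrite subrr; exact: ideal_gen0.
- by move=> _ -> *; rewrite subrr; exact: ideal_gen0.
- move=> /eqP <- <- _ /andP[ab _] /andP[ab' _].
  exact: loop_difference_in_ideal.
Qed.

Definition mass_zero x := forall t, live t -> mass K t x = 0.

(** By bilinearity it is enough to multiply by a path [p].  If [p] is trivial
    the type that is read does not change; otherwise its length drops below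
    two, and every such type is live. *)
Lemma mass_zero_ideal : two_sided_ideal (mass_zero : set (pathAlg K G)).
Proof.
split=> [t _|x y hx hy t lt|y x hx|y x hx].
- by rewrite linear0.
- by rewrite linearD hx // hy // addr0.
- elim/pathAlg_ind: y => [t _|c p y IHy t lt].
    by rewrite mul0r linear0.
  rewrite mulrDl -scalerAl; apply: scalar_lincomb0; last exact: IHy.
  case: t lt => [[a b] n] lt; rewrite mass_pvecMl.
  case: ifP => [/andP[/eqP pa pn]|//]; apply: hx; move: lt; rewrite /live /=.
  have [p0|] := posnP (plen p); last by case: (plen p) pn => // k; lia.
  by rewrite p0 subn0 (plen0_triv p0) /ptgt /= pa.
- elim/pathAlg_ind: y => [t _|c p y IHy t lt].
    by rewrite mulr0 linear0.
  rewrite mulrDr -scalerAr; apply: scalar_lincomb0; last exact: IHy.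
  case: t lt => [[a b] n] lt; rewrite mass_pvecMr.
  case: ifP => [/andP[/eqP pb pn]|//]; apply: hx; move: lt; rewrite /live /=.
  have [p0|] := posnP (plen p); last by case: (plen p) pn => // k; lia.
  by rewrite p0 subn0 -pb (plen0_triv p0) /ptgt /psrc /=.
Qed.

Lemma mass_zigzag_ideal x t : zz_ideal x -> live t -> mass K t x = 0.
Proof.
move=> /(_ _ mass_zero_ideal) h; move: t; apply: h.
have pvec0 p : ~~ live (ptype p) -> mass_zero [vec p].
  move=> np t lt; rewrite [LHS]mass_pvec; case: eqP => // e.
  by rewrite e lt in np.
rewrite /zigzag_rel; case: ifP => _ {}x.
  case=> p /= p2 <-; apply: pvec0; apply/negP => /live_lt3.
  by rewrite ltnNge p2.
case=> [[p [a [b [c [vp ac ->]]]]]|[p [q [a [b [c [vp vq ->]]]]]]].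
  by apply: pvec0; rewrite /live /ptype /psrc /ptgt /plen vp /=.
move=> t _; rewrite linearB; apply/eqP; rewrite subr_eq0; apply/eqP.
rewrite [LHS]mass_pvec [RHS]mass_pvec.
by rewrite /ptype /psrc /ptgt /plen vp vq.
Qed.

End ZigzagIdeal.

(** * Zigzag algebras of graphs with an edge *)

Section ZigzagQuotient.
Variables (K : fieldType) (G : connGraph).
Implicit Types (a b : G) (c : K) (p q r : qpath G) (x y : pathAlg K G).
Implicit Types (t : (G * G) * nat).

Local Notation "[ 'vec' p ]" := (pvec K p : pathAlg K G) (at level 0).
Local Notation zz_ideal := (ideal_gen (@zigzag_rel K G)).
Local Notation Q := (quotAlg (@zigzag_proper K G)).
Local Notation pi := (qproj (@zigzag_proper K G)).

Definition occupied t : bool := live t && `[< exists p, ptype p = t >].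

(** An index set for the basis of the zigzag algebra: the live types that are
    types of paths.  Live types have length at most two, so the length is
    kept in ['I_3] to have finitely many. *)
Definition spot : Type := {t : (G * G) * 'I_3 | occupied (t.1, t.2 : nat)}.
HB.instance Definition _ := Finite.on spot.

Definition spot_type (i : spot) : (G * G) * nat := ((val i).1, (val i).2 : nat).

Lemma spot_type_inj : injective spot_type.
Proof.
move=> i j [e1 e2]; apply: val_inj.
rewrite [LHS]surjective_pairing [RHS]surjective_pairing e1.
by congr pair; exact: val_inj.
Qed.

Lemma spot_live i : live (spot_type i).
Proof. by have /andP[] := valP i. Qed.

Lemma spot_type_occurs i : exists p, ptype p = spot_type i.
Proof. by have /andP[_ /asboolP] := valP i. Qed.

Definition spot_path i : qpath G := sval (cid (spot_type_occurs i)).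

Lemma ptype_spot_path i : ptype (spot_path i) = spot_type i.
Proof. exact: svalP (cid (spot_type_occurs i)). Qed.

Lemma spotP t : occupied t -> exists i, spot_type i = t.
Proof.
case: t => s n ot; have n3 : (n < 3)%N by case/andP: ot => /live_lt3.
pose P (u : (G * G) * 'I_3) := is_true (occupied (u.1, u.2 : nat)).
by exists (exist P (s, Ordinal n3) ot).
Qed.

(** The difference is linear in [x], so [x] may be taken to be a path.  If its
    type is live, the sum reduces to the chosen path of that type; otherwise
    every term vanishes and the path itself is in the ideal. *)
Lemma normal_form x :
  zz_ideal (x - \sum_(i : spot) mass K (spot_type i) x *: [vec spot_path i]).
Proof.
elim/pathAlg_ind: x => [|c p x IHx].
  rewrite sub0r big1 ?oppr0 => [|i _]; first exact: ideal_gen0.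
  by rewrite linear0 scale0r.
rewrite (residue_linear (fun i => mass K (spot_type i))
                        (fun i => [vec spot_path i])).
apply: ideal_gen_linear IHx => /=.
have [lp|dp] := boolP (live (ptype p)).
  have [|i ei] := @spotP (ptype p).
    by rewrite /occupied lp; apply/asboolP; exists p.
  have -> : \sum_j mass K (spot_type j) [vec p] *: [vec spot_path j] =
            [vec spot_path i].
    rewrite (bigD1 i) //= mass_pvec ei eqxx scale1r big1 => [|j ne].
      exact: addr0.
    by rewrite mass_pvec -ei (inj_eq spot_type_inj) eq_sym (negPf ne) scale0r.
  by apply: live_paths_congr; rewrite ?ptype_spot_path.
rewrite big1 ?subr0 => [|i _]; first exact: dead_path_in_ideal.
rewrite mass_pvec; case: eqP => [e|_]; last exact: scale0r.
by rewrite e spot_live in dp.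
Qed.

Lemma mass_zero_zigzag_ideal x :
  (forall t, live t -> mass K t x = 0) -> zz_ideal x.
Proof.
move=> x0; have := normal_form x; rewrite big1 ?subr0 // => i _.
by rewrite x0 ?scale0r //; exact: spot_live.
Qed.

(** The live masses descend to the quotient, where they form the dual basis of
    the classes of the chosen paths. *)
Lemma zigzag_finite_dimensional : finite_dimensional Q.
Proof.
have mass_I i x : zz_ideal x -> mass K (spot_type i) x = 0.
  by move=> Ix; apply: mass_zigzag_ideal (spot_live i).
pose coord i := scalar_descends (@zigzag_proper K G) (mass_I i).
apply: (@dual_basis_finite_dimensional K Q _ (fun i : spot => sval (coord i))
          (fun i : spot => pi [vec spot_path i])) => [i j|].
  rewrite (svalP (coord i)) mass_pvec ptype_spot_path (inj_eq spot_type_inj).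
  by rewrite eq_sym.
elim/qind => x x0; apply/qproj_eq0; apply: mass_zero_zigzag_ideal => t lt.
have [ot|nt] := boolP (occupied t).
  by have [i <-] := spotP ot; rewrite -(svalP (coord i)).
apply: mass_unoccupied => p pt; move: nt; rewrite /occupied lt.
by move/negP; apply; apply/asboolP; exists p.
Qed.

Lemma path_pieceP n x :
  path_piece n x <-> forall p, plen p != n -> (x : {malg K[qpath G]})@_p = 0.
Proof.
split=> [xn p pn|xn p].
  by apply/eqP; rewrite mcoeff_eq0; apply: contra pn => /xn/eqP.
by apply: contraTeq => /xn/eqP; rewrite mcoeff_eq0.
Qed.

Lemma lext_path_piece (w : qpath G -> K) n x :
  path_piece n x -> (forall p, plen p = n -> w p = 0) -> lext w x = 0.
Proof.
move=> xn w0; rewrite /lext big_seq big1 // => p px.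
by rewrite w0 ?mulr0 //; exact: xn.
Qed.

Lemma mass_path_piece n t x : path_piece n x -> t.2 != n -> mass K t x = 0.
Proof.
move=> xn tn; apply: (lext_path_piece xn) => p pn.
by case: eqP => // e; rewrite -e /= pn eqxx in tn.
Qed.

Lemma path_piece_pvec p : path_piece (plen p) [vec p].
Proof.
apply/path_pieceP => q; rewrite mcoeff_pvec => pq.
by rewrite (introF eqP _) // => e; rewrite e eqxx in pq.
Qed.

Lemma path_piece_linear n c x y :
  path_piece n x -> path_piece n y -> path_piece n (c *: x + y).
Proof.
move=> /path_pieceP xn /path_pieceP yn; apply/path_pieceP => p pn.
apply: (etrans (mcoeffD p (c *: x) y)).
rewrite (yn p pn) addr0; apply: (etrans (mcoeffZ c x p)).
by rewrite (xn p pn) mulr0.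
Qed.

Lemma path_piece0 n : path_piece n (0 : pathAlg K G).
Proof. by apply/path_pieceP => p _; exact: mcoeff0. Qed.

Lemma path_piece_sum n (I : Type) (s : seq I) (P : pred I) (c : I -> K)
    (v : I -> pathAlg K G) :
  (forall i, P i -> path_piece n (v i)) ->
  path_piece n (\sum_(i <- s | P i) c i *: v i).
Proof.
move=> vn; elim/big_rec: _ => [|i x /vn vi xn]; first exact: path_piece0.
exact: path_piece_linear.
Qed.

(** Components of [x] are obtained by grouping its normal form by length.
    They are unique because a mass of length [n] sees only the component of
    degree [n]. *)
Lemma zigzag_grading : is_grading (piece (zigzag_quot K G)).
Proof.
split=> [n| |m n|x|N f fn f0 n nN].
- split=> [|c _ _ [x xn <-] [y yn <-]].
    by exists 0; [exact: path_piece0|exact: linear0].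
  by exists (c *: x + y); [exact: path_piece_linear|exact: linearP].
- exists 1 => //; rewrite [1]/(pone K G) /pone.
  under eq_bigr => a _ do rewrite -[pvec _ _]scale1r.
  by apply: path_piece_sum => a _; exact: (@path_piece_pvec (triv_path a)).
- move=> _ _ [x /path_pieceP xm <-] [y /path_pieceP yn <-].
  exists (x * y); last exact: qproj_mul.
  apply/path_pieceP => p pmn; apply: pmul_coeff0 => q r /pcat_len pqr.
  have [qm|/xm ->] := eqVneq (plen q) m; last exact: mul0r.
  have [rn|/yn ->] := eqVneq (plen r) n; last exact: mulr0.
  by rewrite pqr qm rn eqxx in pmn.
- elim/qind: x => x.
  (* Live types have length less than 3. *)
  exists 3, (fun n => pi (\sum_(i : spot | (val i).2 == n :> nat)
                        mass K (spot_type i) x *: [vec spot_path i])).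
  split=> [n|].
    exists (\sum_(i : spot | (val i).2 == n :> nat)
              mass K (spot_type i) x *: [vec spot_path i]) => //.
    apply: path_piece_sum => i /eqP <-.
    by have := @path_piece_pvec (spot_path i); have [_ ->] := ptype_spot_path i.
  rewrite -linear_sum; apply/qproj_eq.
  have := normal_form x.
  by rewrite (partition_big (fun i : spot => (val i).2) predT).
- have /choice[g gP] : forall k, exists y, path_piece k y /\ pi y = f k.
    by move=> k; have [y yk e] := fn k; exists y.
  have {}f0 : zz_ideal (\sum_(k < N) g k).
    apply: (proj1 (qproj_eq0 (@zigzag_proper K G) _)).
    by rewrite -[RHS]f0 linear_sum; apply: eq_bigr => k _; case: (gP k).
  rewrite -(gP n).2; apply/qproj_eq0; apply: mass_zero_zigzag_ideal => t lt.
  have [tn|tn] := eqVneq t.2 n; last exact: mass_path_piece (gP n).1 tn.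
  have := mass_zigzag_ideal f0 lt.
  rewrite linear_sum (bigD1 (Ordinal nN)) //= big1 ?addr0 // => k kn.
  apply: mass_path_piece (gP k).1 _; rewrite tn eq_sym.
  by apply: contra kn => /eqP e; apply/eqP/val_inj.
Qed.

Lemma ptrace_ideal x : zz_ideal x -> ptrace K G x = 0.
Proof.
move=> Ix; rewrite ptrace_mass big1 // => a _.
by apply: mass_zigzag_ideal => //; rewrite /live /= eqxx.
Qed.

(** A loop at the source complements a vertex, the reversed arrow an arrow,
    and the vertex a loop.  Only the first needs a second vertex. *)
Lemma complementary_path p : #|G| != 1%N -> live (ptype p) ->
  exists q, ptype q = (ptgt p, psrc p, (2 - plen p)%N).
Proof.
move=> G1; case E: (val p) => [a s]; have := valP p.
rewrite /live /ptype /psrc /ptgt /plen E /=.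
case: s {E} => [|b [|c [|d s]]] //=.
- have [b ab] := neighbour_exists a G1.
  have [|q vq] := @qpath_val G a [:: b; a]; first by rewrite /= ab adj_sym ab.
  by exists q; rewrite vq.
- move=> /andP[ab _] _.
  have [|q vq] := @qpath_val G b [:: a]; first by rewrite /= adj_sym ab.
  by exists q; rewrite vq.
- by move=> _ /eqP ->; exists (triv_path c).
Qed.

Lemma ptrace_nondegenerate x : #|G| != 1%N ->
  (forall y, ptrace K G (x * y) = 0) -> zz_ideal x.
Proof.
move=> G1 x0; apply: mass_zero_zigzag_ideal => t lt.
have [[p pt]|nt] := pselect (exists p, ptype p = t); last first.
  by apply: mass_unoccupied => p pt; apply: nt; exists p.
rewrite -pt in lt *; have [q [qs qt qn]] := complementary_path G1 lt.
have := x0 [vec q]; rewrite ptrace_pvecMr qn ?leq_subr // qs qt subKn //.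
by have := live_lt3 lt.
Qed.

Lemma zigzag_quot_graded_symmetric :
  #|G| != 1%N -> graded_symmetric (zigzag_quot K G).
Proof.
move=> G1; split.
- exact: zigzag_finite_dimensional.
- exact: zigzag_grading.
have [tr trE] := scalar_descends (@zigzag_proper K G) ptrace_ideal.
have trM x y : tr (pi x * pi y) = ptrace K G (x * y).
  exact: etrans (congr1 tr (esym (qproj_mul _ x y))) (trE _).
exists tr; split; first split.
- elim/qind => x; elim/qind => y.
  exact: etrans (trM x y) (etrans (ptraceC x y) (esym (trM y x))).
- elim/qind => x x0; apply/qproj_eq0; apply: (ptrace_nondegenerate G1) => y.
  exact: etrans (esym (trM x y)) (x0 _).
exists (- 2%:Z) => n _ [x xn <-] n2; rewrite trE.
apply: (lext_path_piece xn) => p pn; rewrite pn.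
by have [n2'|_] := eqVneq n 2%N; [rewrite n2' subrr in n2|rewrite andbF].
Qed.

End ZigzagQuotient.

(** * Dual numbers *)

Section DualNumbers.
Variable K : fieldType.
Local Notation D := {poly %/ ('X^2 : {poly K})}.

Definition dual_coef (i : nat) (x : D) : K := (x : {poly K})`_i.

Lemma dual_coef_linear i : linear_for *%R (dual_coef i).
Proof. by move=> c x y; rewrite /dual_coef /= coefD coefZ. Qed.
HB.instance Definition _ i :=
  GRing.isLinear.Build K D K *%R (dual_coef i) (dual_coef_linear i).

Lemma dual_coef_ge2 i (x : D) : (2 <= i)%N -> dual_coef i x = 0.
Proof.
move=> i2; apply: big_coef_npoly; apply: leq_trans i2.
by rewrite mk_monic_Xn size_polyXn.
Qed.

Lemma dual_coef_inj (x : D) : (forall i : 'I_2, dual_coef i x = 0) -> x = 0.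
Proof.
move=> x0; apply: val_inj; apply/polyP => i; rewrite coef0.
by have [i2|] := ltnP i 2; [exact: (x0 (Ordinal i2))|exact: dual_coef_ge2].
Qed.

Lemma dual_coef_in_qpoly i (p : {poly K}) : (i < 2)%N ->
  dual_coef i (in_qpoly 'X^2 p) = p`_i.
Proof.
move=> i2; rewrite /dual_coef /= mk_monic_Xn.
rewrite [in RHS](Pdiv.RingMonic.rdivp_eq (monicXn K 2) p).
by rewrite coefD coefMXn i2 add0r.
Qed.

Lemma dual_coefM i (x y : D) : (i < 2)%N ->
  dual_coef i (x * y) = \sum_(j < i.+1) dual_coef j x * dual_coef (i - j) y.
Proof.
move=> i2; pose p : {poly K} := x; pose q : {poly K} := y.
exact: etrans (dual_coef_in_qpoly (p * q) i2) (coefM p q i).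
Qed.

Definition dual_monomial (i : 'I_2) : D := in_qpoly 'X^2 'X^i.

Lemma dual_coef_monomial (i j : 'I_2) :
  dual_coef i (dual_monomial j) = (i == j)%:R.
Proof. by rewrite dual_coef_in_qpoly // coefXn. Qed.

(** Here [X] has degree 2, so the coefficient of [X ^ i] is the component of
    degree [2 * i]. *)
Lemma dual_grading : is_grading (piece (dual_numbers K)).
Proof.
split=> [n| |m n x y xm yn|x|N f fn f0 n nN].
- split=> [i _|c x y xn yn i ni]; first exact: coef0.
  rewrite [LHS](dual_coef_linear i c x y) [dual_coef i x]xn //.
  by rewrite [dual_coef i y]yn // mulr0 addr0.
- by case=> // i _; rewrite [LHS]coefC.
- move=> i imn; have [i2|i2] := ltnP i 2; last exact: dual_coef_ge2 i2.
  rewrite [LHS](dual_coefM x y i2) big1 // => j _.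
  have [jm|jm] := eqVneq (2 * j)%N m; last by rewrite [dual_coef j x]xm ?mul0r.
  rewrite [dual_coef (i - j) y]yn ?mulr0 //.
  by apply: contra imn => /eqP <-; rewrite -jm -mulnDr subnKC // -ltnS.
- exists 3.
  exists (fun n =>
    \sum_(i < 2 | (2 * i)%N == n) dual_coef i x *: dual_monomial i).
  split=> [n i ni|].
    rewrite [LHS](linear_sum (dual_coef i)) big1 // => j /eqP jn.
    rewrite linearZ /=; have [i2|i2] := ltnP i 2; last first.
      by rewrite (dual_coef_ge2 _ i2) mulr0.
    rewrite (dual_coef_monomial (Ordinal i2) j) -val_eqE /=.
    by case: eqP => [ij|]; rewrite ?mulr0 // ij jn eqxx in ni *.
  rewrite [LHS](dual_basis_expansion dual_coef_monomial dual_coef_inj).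
  pose deg (i : 'I_2) : 'I_3 := inord (2 * i).
  rewrite (partition_big deg predT) //=.
  apply: eq_bigr => n _; apply: eq_bigl => i.
  by rewrite -val_eqE /= inordK //; case: i => [[|[|]]].
- apply: dual_coef_inj => i.
  have [ni|ni] := eqVneq (2 * i)%N n; last exact: (fn n i ni).
  have := congr1 (dual_coef i) f0.
  rewrite linear_sum (bigD1 (Ordinal nN)) //= big1 => [|k kn].
    by rewrite addr0 linear0.
  apply: (fn k i); rewrite ni eq_sym.
  by apply: contra kn => /eqP e; apply/eqP/val_inj.
Qed.

Lemma dual_numbers_graded_symmetric : graded_symmetric (dual_numbers K).
Proof.
split.
- exact: dual_basis_finite_dimensional dual_coef_monomial dual_coef_inj.
- exact: dual_grading.
exists (dual_coef 1); split; first split.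
- by move=> x y; congr dual_coef; exact: mulrC.
- move=> x x0; apply: dual_coef_inj => i.
  have i2 := ltn_ord i.
  (* X pairs with 1: rev_ord exchanges the exponents 0 and 1. *)
  have := x0 (dual_monomial (rev_ord i)).
  rewrite [LHS]dual_coefM // (bigD1 i) //= big1 ?addr0 => [|j ji].
    have -> : (1 - i)%N = rev_ord i by rewrite /= subSS.
    by rewrite dual_coef_monomial eqxx mulr1.
  have -> : (1 - j)%N = rev_ord j by rewrite /= subSS.
  by rewrite dual_coef_monomial (inj_eq rev_ord_inj) (negPf ji) mulr0.
exists (- 2%:Z) => n x xn n2; apply: (xn 1%N).
by apply: contra n2 => /eqP <-.
Qed.

End DualNumbers.

Theorem proposition1 (R : realType) (G : connGraph) :
  graded_symmetric (zigzag R[i] G).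
Proof.
rewrite /zigzag; case: eqP => [_|/eqP G1].
  exact: dual_numbers_graded_symmetric.
exact: zigzag_quot_graded_symmetric.
Qed.
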